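(* Let $b\in\mathbb{Z}$ with $b\equiv 1\pmod{32}$. Then for every integer $r\ge 3$ such that $x^{2^r}-b$ is irreducible over $\mathbb{Q}$, the pure number field $\mathbb{Q}(\sqrt[2^r]{b})$ is not monogenic.
   Context: $\sqrt[2^r]{b}$ denotes a root of $x^{2^r}-b$. For a number field $K$ with ring of integers $\mathbb{Z}_K$, $K$ is called monogenic if there exists $\eta\in\mathbb{Z}_K$ with $\mathbb{Z}_K=\mathbb{Z}[\eta]$. *)

(* Defs.v *)
From HB Require Import structures.
From mathcomp Require Import all_boot all_order all_algebra all_field.

Set Implicit Arguments.
Unset Strict Implicit.
Unset Printing Implicit Defensive.

Import GRing.Theory.
Local Open Scope ring_scope.

(* A number field is a [fieldExtType rat]. *)

Definition in_ring_of_integers (K : fieldExtType rat) (x : K) : Prop :=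
  integralOver (intr : int -> K) x.

Definition in_Zadjoin (K : fieldExtType rat) (eta x : K) : Prop :=
  exists p : {poly int}, x = (map_poly intr p).[eta].

Definition monogenic (K : fieldExtType rat) : Prop :=
  exists2 eta : K, in_ring_of_integers eta &
    forall x : K, in_ring_of_integers x <-> in_Zadjoin eta x.

(* Main.v *)
Require Import Defs.
From HB Require Import structures.
From mathcomp Require Import all_boot all_order all_algebra all_field.
From mathcomp Require Import qpoly ring.
From Stdlib Require Import Classical.

Set Implicit Arguments.
Unset Strict Implicit.
Unset Printing Implicit Defensive.

Import GRing.Theory.
Local Open Scope ring_scope.

(** Write [b = 1 + 32 k], [beta = alpha ^ (2 ^ (r - 3))] and, for [j = 1, 2, 4],
    [v_j = - 4 k j / (1 + beta ^ j)].  These are algebraic integers whose pairwise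
    products lie in [2 Z_K], and none of them is nilpotent modulo 2, so there are
    three distinct places above 2, the [j]-th one being a unit at [v_j].  There
    [1 + beta ^ j] is divisible by 4, so that [alpha - 1] satisfies an Eisenstein
    equation and is a uniformizer, and the residue field is [F_2].  If [Z_K] were
    [Z[eta]], the three places would be separated by the residue of [eta], which
    takes only two values. *)

(** * Evaluation of integer polynomials *)

Definition int_eval (R : comNzRingType) (x : R) : {poly int} -> R :=
  horner_eval x \o map_poly intr.

HB.instance Definition _ (R : comNzRingType) (x : R) :=
  GRing.RMorphism.copy (int_eval x) (horner_eval x \o map_poly intr).

Lemma int_evalE (R : comNzRingType) (x : R) p :
  int_eval x p = (map_poly intr p).[x].
Proof. by []. Qed.

Lemma int_evalX (R : comNzRingType) (x : R) : int_eval x 'X = x.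
Proof. by rewrite int_evalE map_polyX hornerX. Qed.

Lemma int_evalC (R : comNzRingType) (x : R) c : int_eval x c%:P = c%:~R.
Proof. by rewrite int_evalE map_polyC hornerC. Qed.

Lemma int_eval_sum (R : comNzRingType) (x : R) (p : {poly int}) n : (size p <= n)%N ->
  int_eval x p = \sum_(i < n) (p`_i)%:~R * x ^+ i.
Proof.
move=> szp; rewrite int_evalE (@horner_coef_wide _ n); last first.
  exact: leq_trans (size_poly _ _) szp.
by apply: eq_bigr => i _; rewrite coef_map.
Qed.

Lemma int_eval_comp (R : comNzRingType) (x : R) (p q : {poly int}) :
  int_eval x (p \Po q) = int_eval (int_eval x q) p.
Proof. by rewrite !int_evalE map_comp_poly horner_comp. Qed.

Lemma int_eval_Poly (R : comNzRingType) (x : R) (s : seq int) :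
  int_eval x (Poly s) = foldr (fun c y => y * x + c%:~R) 0 s.
Proof.
elim: s => [|c s IHs] /=; first by rewrite rmorph0.
by rewrite cons_poly_def rmorphD rmorphM /= int_evalX int_evalC IHs.
Qed.

Lemma intr_fext_eq0 (K : fieldExtType rat) (c : int) :
  (c%:~R == 0 :> K) = (c == 0).
Proof. by rewrite -(rmorph_int (in_alg K)) fmorph_eq0 intr_eq0. Qed.

(** Otherwise [p] and [q] would be coprime; coprimality survives the extension to [L] and excludes a
    common root there. *)
Lemma irreducible_root_dvdp (F : fieldType) (L : fieldExtType F)
    (p q : {poly F}) (x : L) :
  irreducible_poly p -> root (map_poly (in_alg L) p) x ->
  root (map_poly (in_alg L) q) x -> p %| q.
Proof.
move=> irr_p px qx; apply: contraT => npq.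
have: coprimep (map_poly (in_alg L) p) (map_poly (in_alg L) q).
  by rewrite coprimep_map irreducible_poly_coprime.
by move/coprimep_root/(_ px); rewrite (rootP qx) eqxx.
Qed.

(** * Powers of a pure radical: independence, non-nilpotence modulo 2, explicit relations *)

Section Pure.

Variables (K : fieldExtType rat) (b : int) (n : nat) (alpha : K).
Hypothesis b_irr : irreducible_poly ('X^n - (b%:~R)%:P : {poly rat}).
Hypothesis alpha_root : alpha ^+ n = b%:~R.

Lemma pure_gt0 : (0 < n)%N.
Proof.
case: b_irr; case: n => // + _.
by rewrite expr0 -polyC1 -polyCB size_polyC; case: eqP.
Qed.

(** A nonzero such [p] would make ['X^n - b] divide [p \Po 'X^e], whose degree is at most
    [(d - 1) * e < n]. *)
Lemma pure_independent (d e : nat) (p : {poly int}) : n = (d * e)%N ->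
  (size p <= d)%N -> int_eval (alpha ^+ e) p = 0 -> p = 0.
Proof.
move=> ne szp p0; apply/eqP/contraT => nz_p.
have e_gt0 : (0 < e)%N by move: pure_gt0; rewrite ne muln_gt0 => /andP[].
pose q := map_poly (intr : int -> rat) p \Po 'X^e.
have szq : size (map_poly (intr : int -> rat) p) = size p.
  by rewrite size_map_inj_poly //; apply: intr_inj.
have := size_comp_poly (map_poly (intr : int -> rat) p) 'X^e.
rewrite szq size_polyXn /= -/q => szqq.
have nz_q : q != 0.
  by rewrite /q comp_poly_eq0 ?size_polyXn // -size_poly_eq0 szq size_poly_eq0.
have : 'X^n - (b%:~R)%:P %| q.
  apply: (@irreducible_root_dvdp _ K _ _ alpha) => //; apply/rootP.
    rewrite rmorphB /= map_polyXn map_polyC /= !hornerE alpha_root.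
    by rewrite -[_%:A]/(in_alg K _) rmorph_int subrr.
  rewrite /q map_comp_poly map_polyXn horner_comp hornerXn -map_poly_comp.
  rewrite -[RHS]p0 int_evalE; congr _.[_]; apply: eq_map_poly => z.
  by rewrite /= -[LHS]/(in_alg K _) rmorph_int.
move/dvdp_leq => /(_ nz_q); rewrite size_XnsubC ?pure_gt0 // => le_n.
have: (n <= (size q).-1)%N by case: (size q) le_n.
rewrite szqq ne leq_pmul2r // => le_d.
move: nz_p szp le_d; rewrite -size_poly_gt0; case: (size p) => //= s _.
by rewrite ltnNge => /negPf ->.
Qed.


(** Since [v = m / (1 + alpha ^+ e)], clearing denominators in [p(v) = 0] gives a relation of degree
    below [d] for [alpha ^+ e], to which [pure_independent] applies. *)
Lemma fraction_independent (d e : nat) (v : K) (m : int) (p : {poly int}) :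
    n = (d * e)%N -> m != 0 -> v * (1 + alpha ^+ e) = m%:~R ->
  (size p <= d)%N -> int_eval v p = 0 -> p = 0.
Proof.
move=> ne nz_m vm szp p0.
case: d ne szp => [|d] ne szp; first by apply/eqP; rewrite -size_poly_leq0.
(* [u] is the reversal of [p] with coefficients scaled by powers of [m]: [u(y) = y^d p(m / y)].
   After the case split [d] is the degree bound itself. *)
pose u := \poly_(j < d.+1) (p`_(d - j) * m ^+ (d - j)).
have uX : u \Po ('X + 1) = 0.
  apply: (pure_independent (d := d.+1) (e := e)) => //.
    rewrite size_comp_poly2; first exact: size_poly.
    by rewrite -[1]opprK -polyCN size_XsubC.
  rewrite int_eval_comp rmorphD rmorph1 /= int_evalX addrC.
  rewrite (@int_eval_sum _ _ _ d.+1) ?size_poly //.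
  transitivity ((1 + alpha ^+ e) ^+ d * int_eval v p); last by rewrite p0 mulr0.
  rewrite (int_eval_sum _ szp) big_distrr /= (reindex_inj rev_ord_inj) /=.
  apply: eq_bigr => i _; rewrite subSS coef_poly ltnS leq_subr.
  have le_id : (i <= d)%N by rewrite -ltnS.
  rewrite subKn // rmorphM rmorphXn /= -vm exprMn.
  have -> : (1 + alpha ^+ e) ^+ d = (1 + alpha ^+ e) ^+ (d - i) * (1 + alpha ^+ e) ^+ i.
    by rewrite -exprD subnK.
  by ring.
have u0 : u = 0.
  apply/eqP; rewrite -size_poly_eq0 -(@size_comp_poly2 _ u ('X + 1)).
    by rewrite uX size_poly0.
  by rewrite -[1]opprK -polyCN size_XsubC.
apply/polyP => i; rewrite coef0; have [le_id | lt_di] := leqP i d; last first.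
  by rewrite nth_default // (leq_trans szp).
have := coef_poly d.+1 (fun j => p`_(d - j) * m ^+ (d - j)) (d - i).
rewrite -/u u0 coef0 ltnS leq_subr subKn // => /esym/eqP.
by rewrite mulf_eq0 expf_eq0 (negPf nz_m) andbF orbF => /eqP.
Qed.

(** Division by the monic [g] stays in integer polynomials, and [fraction_independent] kills the
    remainder; so [g] divides [p], and parity at 1 is inherited. *)
Lemma relation_even_at_one (d e : nat) (v : K) (m : int) (g p : {poly int}) :
    n = (d * e)%N -> m != 0 -> v * (1 + alpha ^+ e) = m%:~R ->
    g \is monic -> size g = d.+1 -> int_eval v g = 0 -> (2 %| g.[1])%Z ->
  int_eval v p = 0 -> (2 %| p.[1])%Z.
Proof.
move=> ne nz_m vm mon_g szg g0 g1 p0.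
have Dp := Pdiv.RingMonic.rdivp_eq mon_g p.
have r0 : Pdiv.Ring.rmodp p g = 0.
  apply: (fraction_independent (d := d) (e := e) (v := v) (m := m)) => //.
    by rewrite -ltnS -szg Pdiv.Ring.ltn_rmodpN0 // monic_neq0.
  by move: p0; rewrite {1}Dp rmorphD rmorphM /= g0 mulr0 add0r.
by rewrite Dp r0 addr0 hornerM dvdz_mull.
Qed.

(** An integral equation of [w = v ^+ N / 2], rescaled, becomes a monic relation of [v] whose other
    coefficients are all even. Its value at 1 is odd, against [relation_even_at_one]. *)
Lemma power_not_even (d e N : nat) (v w : K) (m : int) (g : {poly int}) :
    n = (d * e)%N -> m != 0 -> v * (1 + alpha ^+ e) = m%:~R ->
    g \is monic -> size g = d.+1 -> int_eval v g = 0 -> (2 %| g.[1])%Z ->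
  integralOver (intr : int -> K) w -> v ^+ N <> 2 * w.
Proof.
move=> ne nz_m vm mon_g szg g0 g1 [q mon_q /rootP qw] vN.
pose D := (size q).-1.
have szq : size q = D.+1 by rewrite prednK // size_poly_gt0 monic_neq0.
(* This is [2^D q(X^N / 2)], so that [h(v) = 2^D q(w)]. *)
pose h := \poly_(i < D.+1) (q`_i * 2 ^+ (D - i)) \Po 'X^N.
have h0 : int_eval v h = 0.
  rewrite int_eval_comp rmorphXn /= int_evalX vN.
  transitivity (2 ^+ D * int_eval w q); last by rewrite int_evalE qw mulr0.
  rewrite !(@int_eval_sum _ _ _ D.+1) ?size_poly ?szq // big_distrr /=.
  apply: eq_bigr => i _; rewrite coef_poly ltn_ord rmorphM rmorphXn /= -mulrA.
  rewrite [RHS]mulrCA; congr (_ * _); rewrite exprMn mulrA -exprD subnK //.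
  by rewrite -ltnS.
have := relation_even_at_one ne nz_m vm mon_g szg g0 g1 h0.
rewrite horner_comp hornerXn expr1n horner_poly big_ord_recr /= subnn !mulr1.
have -> : q`_D = 1 by move/monicP: mon_q; rewrite lead_coefE.
rewrite expr1n rpredDl //; apply: (big_ind (fun z : int => (2 %| z)%Z)) => //.
  by move=> x y; apply: rpredD.
by move=> i _; rewrite expr1n mulr1 -(subnSK (ltn_ord i)) exprS dvdz_mull ?dvdz_mulr.
Qed.

End Pure.

(* With [m = - 4 k j] and [b = 1 + 32 k = 1 - d m], the polynomials [h] come from
   dividing [b v^d - (m - v)^d = 0] by [- d m = 32 k]. *)
Lemma fraction_relation (K : fieldExtType rat) (k : int) (j d : nat)
    (v delta : K) :
    (j, d) \in [:: (1, 8); (2, 4); (4, 2)]%N -> k != 0 ->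
    v * (1 + delta) = (- (4 * k * j%:R))%:~R -> delta ^+ d = (1 + 32 * k)%:~R ->
  exists2 h : {poly int}, (size h <= d.-1)%N &
    v ^+ d = v ^+ d.-1 + 2 * int_eval v h.
Proof.
move=> jd nz_k vm deltad.
have vd : ((- (4 * k * j%:R))%:~R - v) ^+ d = (1 + 32 * k)%:~R * v ^+ d.
  by rewrite -vm mulrDr mulr1 addrC addKr exprMn deltad mulrC.
have nz32x : 32 * k%:~R != 0 :> K.
  by rewrite mulf_neq0 ?intr_fext_eq0 // (intr_fext_eq0 K 32).
move: jd vd; rewrite !inE => /or3P[] /eqP[-> ->] /= vd.
- exists (Poly [:: 1024 * k ^+ 7; 2048 * k ^+ 6; 1792 * k ^+ 5;
    896 * k ^+ 4; 280 * k ^+ 3; 56 * k ^+ 2; 7 * k]).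
    exact: size_Poly.
  apply: (mulfI nz32x); rewrite int_eval_Poly /=.
  apply/eqP; rewrite -subr_eq0; apply/eqP.
  transitivity ((1 + 32 * k)%:~R * v ^+ 8 -
      ((- (4 * k * 1%:R))%:~R - v) ^+ 8); first by ring.
  by rewrite vd; ring.
- exists (Poly [:: 64 * k ^+ 3; 32 * k ^+ 2; 6 * k]).
    exact: size_Poly.
  apply: (mulfI nz32x); rewrite int_eval_Poly /=.
  apply/eqP; rewrite -subr_eq0; apply/eqP.
  transitivity ((1 + 32 * k)%:~R * v ^+ 4 -
      ((- (4 * k * 2%:R))%:~R - v) ^+ 4); first by ring.
  by rewrite vd; ring.
exists (Poly [:: 4 * k]); first exact: size_Poly.
apply: (mulfI nz32x); rewrite int_eval_Poly /=.
apply/eqP; rewrite -subr_eq0; apply/eqP.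
transitivity ((1 + 32 * k)%:~R * v ^+ 2 -
    ((- (4 * k * 4%:R))%:~R - v) ^+ 2); first by ring.
by rewrite vd; ring.
Qed.

(** * Reduction modulo 2 and residues of the generator *)

Local Notation red2 := (map_poly (intr : int -> 'F_2)).

Lemma red2_surj (p : {poly 'F_2}) : exists q : {poly int}, red2 q = p.
Proof.
exists (map_poly (fun x : 'F_2 => (x : nat)%:Z) p).
by apply/polyP => i; rewrite coef_map coef_map_id0 //= -[RHS]natr_Zp.
Qed.

Lemma red2_eq0 (p : {poly int}) : red2 p = 0 -> exists q : {poly int}, p = 2 * q.
Proof.
move=> p0; exists (\poly_(i < size p) (p`_i %/ 2)%Z).
apply/polyP => i; rewrite mulr_natl coefMn coef_poly -[RHS]mulr_natr.
case: ltnP => [_ | /(nth_default 0) ->]; last by rewrite mul0r.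
have: ((p`_i)%:~R : 'F_2) == 0 by rewrite -coef_map p0 coef0.
have ch2 : 2%N \in [pchar 'F_2] by rewrite pchar_Fp.
by rewrite -(dvdz_pcharf ch2) => /divzK.
Qed.

(** The reductions of the relations of [eta] form an ideal of [F_2[x]], nonzero because [eta] has a
    monic relation; [f] is a relation whose nonzero reduction has least degree. *)
Lemma annihilator_mod2_principal (K : fieldExtType rat) (eta : K) :
    integralOver (intr : int -> K) eta ->
  exists f : {poly int}, [/\ int_eval eta f = 0, red2 f != 0
    & forall p, int_eval eta p = 0 -> red2 f %| red2 p].
Proof.
case=> q mon_q /rootP q0.
have: exists n, exists2 p : {poly int}, int_eval eta p = 0 &
    red2 p != 0 /\ (size (red2 p) <= n)%N.
  exists (size (red2 q)), q => //; split=> //.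
  by rewrite monic_neq0 // monic_map.
case=> n; elim: n => [|n IHn] [f f0 [nz_f szf]].
  by move: nz_f; rewrite -size_poly_leq0 szf.
(* Either a relation with smaller nonzero reduction exists and the induction continues, or [f] is
   minimal and Euclidean remainders by it vanish. *)
case: (classic (exists2 p : {poly int}, int_eval eta p = 0 &
    red2 p != 0 /\ (size (red2 p) <= n)%N)) => [|no_less]; first exact: IHn.
exists f; split=> // p p0; apply/modp_eq0P/eqP; apply/negPn/negP => nz_r.
have [u Du] := red2_surj (red2 p %/ red2 f).
have Dr : red2 (p - u * f) = red2 p %% red2 f.
  by rewrite rmorphB rmorphM /= Du {1}[red2 p](divp_eq _ (red2 f)) addrC addKr.
apply: no_less; exists (p - u * f).
  by rewrite rmorphB rmorphM /= p0 f0 mulr0 subrr.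
by rewrite Dr; split=> //; rewrite -ltnS (leq_trans _ szf) // ltn_modp.
Qed.

(** If [p] vanished at every root of [red2 f], then [red2 f] would divide a power of [red2 p],
    making [p(eta)] nilpotent modulo [2 Z[eta]]. *)
Lemma mod2_root_exists (K : fieldExtType rat) (F : closedFieldType)
    (iota : {rmorphism 'F_2 -> F}) (eta : K) (p : {poly int}) :
    integralOver (intr : int -> K) eta ->
    (forall N q, int_eval eta p ^+ N <> 2 * int_eval eta q) ->
  exists2 rho : F, int_eval rho p != 0 &
    forall q, int_eval eta q = 0 -> int_eval rho q = 0.
Proof.
move=> /annihilator_mod2_principal[f [f0 nz_f min_f]] p_nonnil.
have evalE (rho : F) q : int_eval rho q = (map_poly iota (red2 q)).[rho].
  rewrite -map_poly_comp int_evalE; congr _.[_].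
  by apply: eq_map_poly => z; rewrite /= rmorph_int.
have [rs Df] := closed_field_poly_normal (map_poly iota (red2 f)).
have nz_lf : lead_coef (map_poly iota (red2 f)) != 0.
  by rewrite lead_coef_eq0 map_poly_eq0.
case: (boolP (all (fun rho => int_eval rho p == 0) rs)) => [p_rs|]; last first.
  case/allPn => rho rs_rho nz_p; exists rho => // q /min_f.
  rewrite -(dvdp_map iota) evalE => /dvdpP[u ->]; rewrite hornerM Df hornerZ.
  have: root (\prod_(z <- rs) ('X - z%:P)) rho by rewrite root_prod_XsubC.
  by move/rootP ->; rewrite !mulr0.
(* [rs] lists the roots with multiplicity, so its length is a large enough exponent. *)
have: red2 f %| red2 p ^+ size rs.
  rewrite -(dvdp_map iota) Df dvdpZl // rmorphXn /=.
  elim: rs p_rs {Df} => [|rho rs IHrs] /=; first by rewrite big_nil dvd1p.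
  case/andP=> p_rho /IHrs dv; rewrite big_cons exprS dvdp_mul //.
  by rewrite dvdp_XsubCl /root -evalE.
case/dvdpP=> u Du; have [u' Du'] := red2_surj u.
have [|w Dw] := @red2_eq0 (p ^+ size rs - u' * f).
  by rewrite rmorphB rmorphXn rmorphM /= Du Du' subrr.
case: (p_nonnil (size rs) w); rewrite -rmorphXn -[p ^+ _](subrK (u' * f)) Dw.
by rewrite rmorphD !rmorphM /= f0 mulr0 addr0 rmorph_nat.
Qed.

(** * Local analysis at a place above 2 *)

(** Frobenius modulo 2, by repeated squaring. The extra factor [x] in the error term is what makes
    the later equation Eisenstein. *)
Lemma binomial_two_power (R : comNzRingType) (x : R) (i : nat) :
  exists g : {poly int},
    (1 + x) ^+ (2 ^ i) = 1 + x ^+ (2 ^ i) + 2 * x * int_eval x g.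
Proof.
elim: i => [|i [g IHi]]; first by exists 0; rewrite rmorph0 mulr0 addr0 !expr1.
(* Read off from the square of [1 + y + 2 x g] with [y = x * x ^+ (2 ^ i).-1], after removing
   [1 + y ^+ 2] and the factor [2 x]. *)
exists ('X^((2 ^ i).-1) + 2 * ('X * g ^+ 2 + g * (1 + 'X^(2 ^ i)))).
have xi : x ^+ (2 ^ i) = x * x ^+ (2 ^ i).-1.
  by rewrite -exprS prednK // expn_gt0.
rewrite expnS mulnC !exprM IHi !(rmorphD, rmorphM, rmorphXn, rmorph_nat) /=.
rewrite rmorph1 int_evalX xi; ring.
Qed.

Section LocalDegreeOne.

Variables (T : comNzRingType) (K : fieldType) (F : fieldType).
Variables (eps : {rmorphism T -> K}) (psi : {rmorphism T -> F}).
Hypothesis char2 : 2 = 0 :> F.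
Hypothesis ker_psi : forall t, eps t = 0 -> psi t = 0.
Variables (theta v : T) (i d : nat) (mu : int) (h : {poly int}).
Hypothesis nz_theta : eps theta != 0.
Hypothesis psi_v_neq0 : psi v != 0.
Hypothesis d_gt0 : (0 < d)%N.
Hypothesis v_fraction :
  eps v * (1 + (1 + eps theta) ^+ (2 ^ i)) = (4 * mu)%:~R.
Hypothesis v_relation :
  eps v ^+ d = eps v ^+ d.-1 + 2 * int_eval (eps v) h.

(** Thus [psi] is a residue map on the image of [eps], and identities in [K] can be read in [F]. *)
Let psi_eq t u : eps t = eps u -> psi t = psi u.
Proof.
move=> tu; apply/eqP; rewrite -subr_eq0 -rmorphB; apply/eqP/ker_psi.
by rewrite rmorphB tu subrr.
Qed.

Let eps_eval t p : int_eval (eps t) p = eps (int_eval t p).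
Proof.
rewrite !int_evalE -horner_map -map_poly_comp; congr _.[_].
by apply: eq_map_poly => z; rewrite /= rmorph_int.
Qed.

(** The subring [Z[theta, v]] of [T], given inductively so that residues and expansions are computed
    by induction on how an element is built. *)
Inductive adjoined : T -> Prop :=
| adjoined_int c : adjoined c%:~R
| adjoined_theta : adjoined theta
| adjoined_v : adjoined v
| adjoinedD t u : adjoined t -> adjoined u -> adjoined (t + u)
| adjoinedM t u : adjoined t -> adjoined u -> adjoined (t * u).

Let adjoinedX t n : adjoined t -> adjoined (t ^+ n).
Proof.
move=> At; elim: n => [|n IHn]; first exact: (adjoined_int 1).
by rewrite exprS; apply: adjoinedM.
Qed.

Let adjoined_eval t p : adjoined t -> adjoined (int_eval t p).
Proof.
move=> At; rewrite (int_eval_sum _ (leqnn _)).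
apply: big_ind => [|x y|j _]; first exact: (adjoined_int 0).
  exact: adjoinedD.
by apply: adjoinedM; [apply: adjoined_int | apply: adjoinedX].
Qed.

Let char2z : (2 : int)%:~R = 0 :> F.
Proof. by rewrite -char2. Qed.

Let char2_int (c : int) : c%:~R = ((c %% 2)%Z)%:~R :> F.
Proof.
by rewrite {1}(divz_eq c 2) rmorphD rmorphM /= char2z mulr0 add0r.
Qed.

Let modz2 (c : int) : (c %% 2)%Z = 0 \/ (c %% 2)%Z = 1.
Proof.
have := modz_ge0 c (isT : 2 != 0 :> int); have := ltz_pmod c (isT : 0 < 2 :> int).
by case: (c %% 2)%Z => [[|[|]]|] //; [left | right].
Qed.

(** In characteristic 2, [v_fraction] reduces to [psi v * psi theta ^+ (2 ^ i) = 0]. *)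
Let psi_theta : psi theta = 0.
Proof.
have: psi (v * (1 + (1 + theta) ^+ (2 ^ i))) = psi (4 * mu)%:~R.
  apply: psi_eq.
  by rewrite rmorphM rmorphD rmorphXn rmorphD !rmorph1 v_fraction rmorph_int.
rewrite rmorph_int rmorphM rmorphD rmorphXn rmorphD !rmorph1.
rewrite (_ : 4 * mu = 2 * (2 * mu)); last by ring.
rewrite rmorphM /= char2z mul0r => /eqP.
rewrite mulf_eq0 (negPf psi_v_neq0) /=.
have [g ->] := binomial_two_power (psi theta) i.
rewrite char2 !mul0r addr0 addrA -[1 + 1]/(2 : F) char2 add0r expf_eq0.
by case/andP=> _ /eqP.
Qed.

(** Modulo 2, [v_relation] reads [v ^+ d = v ^+ d.-1], and [psi v] can be cancelled. *)
Let psi_v : psi v = 1.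
Proof.
have: psi (v ^+ d) = psi (v ^+ d.-1 + 2 * int_eval v h).
  apply: psi_eq; rewrite rmorphXn v_relation rmorphD rmorphXn rmorphM.
  by rewrite rmorph_nat eps_eval.
rewrite rmorphD rmorphM rmorph_nat char2 mul0r addr0 !rmorphXn.
rewrite -{1}(prednK d_gt0) exprSr -[RHS]mulr1; apply: mulfI.
by rewrite expf_neq0.
Qed.

(** The Eisenstein equation: expanding [v_fraction] gives [theta^(2^i) v = 2 (2 mu - v (1 + theta
    g(theta)))], and the last bracket has residue [-1 = 1]. *)
Let two_times_unit : exists s, [/\ adjoined s, psi s = 1
  & eps (2 * s) = eps (theta ^+ (2 ^ i) * v)].
Proof.
have [g Dg] := binomial_two_power theta i.
exists ((2 * mu)%:~R + (- 1)%:~R * (v * (1 + theta * int_eval theta g))); split.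
- apply: adjoinedD; first exact: adjoined_int.
  apply: adjoinedM; first exact: adjoined_int.
  apply: adjoinedM; first exact: adjoined_v.
  apply: adjoinedD; first exact: (adjoined_int 1).
  apply: adjoinedM; first exact: adjoined_theta.
  exact/adjoined_eval/adjoined_theta.
- rewrite rmorphD rmorph_int rmorphM /= char2z mul0r add0r.
  rewrite rmorphM rmorph_int [psi (v * _)]rmorphM [psi (1 + _)]rmorphD.
  rewrite [psi (theta * _)]rmorphM psi_theta psi_v mul0r rmorph1 addr0 !mulr1.
  by rewrite rmorphN1; apply/eqP; rewrite -subr_eq0 -opprD oppr_eq0 -char2 eqxx.
have: eps (v * (1 + (1 + theta) ^+ (2 ^ i))) = eps (4 * mu)%:~R.
  by rewrite rmorphM rmorphD rmorphXn rmorphD !rmorph1 v_fraction rmorph_int.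
rewrite Dg => Dv; apply/eqP; rewrite -subr_eq0 -rmorphB; apply/eqP.
transitivity (eps ((4 * mu)%:~R) - eps (v * (1 + (1 + theta ^+ (2 ^ i) +
  2 * theta * int_eval theta g)))); last by rewrite Dv subrr.
by rewrite -rmorphB; congr (eps _); ring.
Qed.

Let psi_adjoined a : adjoined a -> psi a = 0 \/ psi a = 1.
Proof.
elim=> [c|||t u _ Ht _ Hu|t u _ Ht _ Hu]; first 1 last.
- by left; exact: psi_theta.
- by right; exact: psi_v.
- rewrite rmorphD; case: Ht => ->; case: Hu => ->; rewrite ?addr0 ?add0r;
    by [left | right | left; exact: char2].
- by rewrite rmorphM; case: Ht => ->; case: Hu => ->; rewrite ?mulr0 ?mul0r ?mulr1;
    by [left | right].
by rewrite rmorph_int char2_int; case: (modz2 c) => ->; [left | right].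
Qed.

(* After localization at [psi], [theta] generates the maximal ideal of [adjoined]. *)
Let psi_kernel_divisible : exists s, [/\ adjoined s, psi s = 1
  & forall a, adjoined a -> psi a = 0 ->
    exists2 a', adjoined a' & eps (s * a) = eps (theta * a')].
Proof.
have [s [As psi_s two_s]] := two_times_unit.
have e_gt0 : (0 < 2 ^ i)%N by rewrite expn_gt0.
have Atv : adjoined (theta ^+ (2 ^ i).-1 * v).
  by apply: adjoinedM; [apply/adjoinedX/adjoined_theta | apply: adjoined_v].
have two_s' : eps (s * 2) = eps (theta * (theta ^+ (2 ^ i).-1 * v)).
  by rewrite mulrC two_s mulrA -exprS prednK.
have Asv : adjoined (s * v ^+ d.-1).
  by apply: adjoinedM => //; apply/adjoinedX/adjoined_v.
(* Up to the factor [s * v ^+ d.-1], of residue 1, each element is an integer modulo [theta]. For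
   [v], this uses [v ^+ d = v ^+ d.-1 + 2 h(v)] and the divisibility of [s * 2] by [theta]. *)
have expand a : adjoined a -> exists (c : int), exists2 a', adjoined a' &
    eps (s * v ^+ d.-1 * a) = eps (s * v ^+ d.-1 * c%:~R + theta * a').
  elim=> [c|||t u _ [c [t' At' Dt]] _ [c' [u' Au' Du]]
             |t u _ [c [t' At' Dt]] Au [c' [u' Au' Du]]].
  - by exists c, 0; rewrite ?mulr0 ?addr0 //; exact: (adjoined_int 0).
  - by exists 0, (s * v ^+ d.-1); rewrite // rmorph0 mulr0 add0r mulrC.
  - exists 1, (theta ^+ (2 ^ i).-1 * v * int_eval v h).
      by apply: adjoinedM => //; apply/adjoined_eval/adjoined_v.
    rewrite -mulrA -exprSr prednK // rmorphM rmorphXn v_relation eps_eval.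
    rewrite [theta * _]mulrA rmorphD [eps (theta * _ * _)]rmorphM -two_s'.
    by rewrite !(rmorphM, rmorphXn) rmorph_nat rmorph1 /=; ring.
  - exists (c + c'), (t' + u'); first exact: adjoinedD.
    rewrite mulrDr rmorphD Dt Du -rmorphD; congr (eps _).
    by rewrite rmorphD /=; ring.
  exists (c * c'), (c%:~R * u' + t' * u).
    by apply: adjoinedD; apply: adjoinedM => //; apply: adjoined_int.
  rewrite mulrA rmorphM Dt -rmorphM mulrDl rmorphD mulrAC [eps (_ * _ * c%:~R)]rmorphM.
  rewrite Du -rmorphM -rmorphD; congr (eps _).
  by rewrite rmorphM /=; ring.
have psi_sv : psi (s * v ^+ d.-1) = 1.
  by rewrite rmorphM rmorphXn psi_s psi_v expr1n mulr1.
exists (s * v ^+ d.-1); split=> // a Aa psi_a.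
have [c [a' Aa' Da]] := expand a Aa.
have c2 : (c %% 2)%Z = 0.
  have := psi_eq Da; rewrite rmorphM psi_a mulr0 rmorphD rmorphM psi_sv mul1r.
  rewrite rmorphM psi_theta mul0r addr0 rmorph_int char2_int.
  by case: (modz2 c) => -> // /esym/eqP; rewrite oner_eq0.
(* The integer [c] has residue 0, hence is even, and [s * 2] supplies the factor [theta]. *)
exists ((c %/ 2)%Z%:~R * (theta ^+ (2 ^ i).-1 * v * v ^+ d.-1) + a').
  apply: adjoinedD => //; apply: adjoinedM; first exact: adjoined_int.
  by apply: adjoinedM => //; apply/adjoinedX/adjoined_v.
rewrite Da {1}(divz_eq c 2) c2 addr0 [theta * (_ + a')]mulrDr 2!rmorphD; congr (_ + _).
transitivity (eps ((c %/ 2)%Z%:~R * v ^+ d.-1) *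
  eps (theta * (theta ^+ (2 ^ i).-1 * v))).
  by rewrite -two_s' -rmorphM; congr (eps _); rewrite rmorphM /=; ring.
by rewrite -rmorphM; congr (eps _); ring.
Qed.

(** Each induction step strips one [theta]: [a] has residue 0, so [s * a] is a multiple of [theta]
    by an adjoined element, and [eps theta] is cancelled in [K]. *)
Let cancel_theta n u t a : adjoined u -> adjoined a -> psi u = 1 ->
  eps (theta ^+ n * u * t) = eps a -> psi t = 0 \/ psi t = 1.
Proof.
have [s [As psi_s div_s]] := psi_kernel_divisible.
elim: n u a => [|n IHn] u a Au Aa psi_u.
  by move/psi_eq; rewrite expr0 mul1r rmorphM psi_u mul1r => ->; apply: psi_adjoined.
move=> Da; have psi_a : psi a = 0.
  by rewrite -(psi_eq Da) exprS !rmorphM psi_theta !mul0r.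
have [a' Aa' Da'] := div_s a Aa psi_a.
apply: (IHn (s * u) a') => //; first exact: adjoinedM.
  by rewrite rmorphM psi_s psi_u mulr1.
apply: (mulfI nz_theta); rewrite -!rmorphM -Da' [RHS]rmorphM -Da -rmorphM.
by congr (eps _); rewrite exprS; ring.
Qed.

(** An odd denominator has residue 1, and factors 2 of [D] are traded for powers of [theta], which
    [cancel_theta] removes. *)
Lemma psi_degree_one (D : int) (p : {poly int}) t : D != 0 ->
  D%:~R * eps t = int_eval (eps theta) p -> psi t = 0 \/ psi t = 1.
Proof.
move=> nz_D Dt; have [s [As psi_s two_s]] := two_times_unit.
have: exists n u a, [/\ adjoined u, adjoined a, psi u = 1
    & eps (D%:~R * theta ^+ n * u * t) = eps a].
  exists 0%N, 1, (int_eval theta p); split.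
  - exact: (adjoined_int 1).
  - exact/adjoined_eval/adjoined_theta.
  - exact: rmorph1.
  by rewrite expr0 !mulr1 rmorphM rmorph_int Dt eps_eval.
have [N] := ubnP `|D|%N; elim: N D nz_D {p Dt} => // N IHN D nz_D leDN.
case=> n [u [a [Au Aa psi_u Da]]].
have [D2 | D2] := modz2 D; last first.
  apply: (cancel_theta (n := n) (u := D%:~R * u) (a := a)) => //.
  - by apply: adjoinedM => //; apply: adjoined_int.
  - by rewrite rmorphM rmorph_int char2_int D2 psi_u mulr1.
  by rewrite -Da; congr (eps _); ring.
have DD : D = (D %/ 2)%Z * 2 by rewrite {1}(divz_eq D 2) D2 addr0.
apply: (IHN (D %/ 2)%Z).
- by apply: contraNneq nz_D => D0; rewrite DD D0.
- rewrite DD abszM in leDN nz_D; rewrite -ltnS (leq_trans _ leDN) //.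
  rewrite ltnS muln2 -addnn -[X in (X < _)%N]addn0 ltn_add2l.
  by rewrite absz_gt0; apply: contraNneq nz_D => ->; rewrite mul0r.
(* Multiplying by [s] turns one factor 2 of [D] into [theta ^+ (2 ^ i) * v]. *)
exists (n + 2 ^ i)%N, (u * v), (s * a); split.
- by apply: adjoinedM => //; apply: adjoined_v.
- exact: adjoinedM.
- by rewrite rmorphM psi_u psi_v mulr1.
rewrite [RHS]rmorphM -Da -rmorphM exprD.
transitivity (eps ((D %/ 2)%Z%:~R * theta ^+ n * u * t) * eps (theta ^+ (2 ^ i) * v)).
  by rewrite -rmorphM; congr (eps _); ring.
rewrite -two_s -rmorphM; congr (eps _).
by rewrite [in RHS]DD rmorphM /=; ring.
Qed.

End LocalDegreeOne.

(** * Places of the pure field *)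

Lemma pure_root_integral (K : fieldExtType rat) (b : int) (n : nat) (x : K) :
  (0 < n)%N -> x ^+ n = b%:~R -> in_ring_of_integers x.
Proof.
move=> n_gt0 xn; exists ('X^n - b%:P); first by rewrite monicXnsubC.
apply/rootP; rewrite -int_evalE rmorphB rmorphXn /=.
by rewrite int_evalX int_evalC xn subrr.
Qed.

(** Denominators are cleared in a rational polynomial expression in [alpha], which is then recentred
    at the uniformizer [alpha - 1]. *)
Lemma generator_denominator (K : fieldExtType rat) (alpha x : K) :
  <<1; alpha>>%VS = {:K}%VS ->
  exists D : int, exists2 p : {poly int},
    D != 0 & D%:~R * x = int_eval (alpha - 1) p.
Proof.
move=> Kalpha; have: x \in <<1; alpha>>%VS by rewrite Kalpha memvf.
case/Fadjoin_polyP=> _ /polyOver1P[q ->] ->.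
have [p [D nz_D ->]] := rat_poly_scale q.
exists D, (p \Po ('X + 1)) => //.
rewrite int_eval_comp rmorphD rmorph1 /= int_evalX subrK linearZ /= hornerZ.
rewrite -[_%:A]/(in_alg K _) fmorphV rmorph_int mulVKf.
  rewrite -map_poly_comp int_evalE; congr _.[_].
  by apply: eq_map_poly => z; rewrite /= -[LHS]/(in_alg K _) rmorph_int.
by rewrite intr_fext_eq0.
Qed.

Lemma monic_pure_relation (d : nat) (h : {poly int}) : (0 < d)%N ->
  (size h <= d.-1)%N ->
  let g := 'X^d - ('X^(d.-1) + 2 * h) in g \is monic /\ size g = d.+1.
Proof.
move=> d_gt0 szh g.
have szr : (size (- ('X^(d.-1) + 2 * h)) < size ('X^d : {poly int}))%N.
  rewrite size_polyN size_polyXn ltnS (leq_trans (size_polyD _ _)) //.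
  rewrite geq_max size_polyXn prednK // leqnn /= mulr_natl -scaler_nat.
  by rewrite (leq_trans (size_scale_leq _ _)) // (leq_trans szh) // leq_pred.
split; last by rewrite /g size_polyDl // size_polyXn.
by apply/monicP; rewrite /g lead_coefDl // lead_coefXn.
Qed.

Section DegreeOnePlace.

Variables (K : fieldExtType rat) (F : closedFieldType).
Variables (iota : {rmorphism 'F_2 -> F}) (k : int) (r : nat) (alpha eta : K).
Hypothesis r_ge3 : (3 <= r)%N.
Hypothesis b_irr :
  irreducible_poly ('X^(2 ^ r) - ((1 + 32 * k)%:~R)%:P : {poly rat}).
Hypothesis alpha_root : alpha ^+ (2 ^ r) = (1 + 32 * k)%:~R.
Hypothesis Kalpha : <<1; alpha>>%VS = {:K}%VS.
Hypothesis eta_int : in_ring_of_integers eta.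
Hypothesis eta_gen : forall x, in_ring_of_integers x -> in_Zadjoin eta x.

(** For [k = 0] the binomial has the root 1, so it would divide ['X - 1], of smaller degree. *)
Lemma radicand_shift_neq0 : k != 0.
Proof.
apply: contraL (leqnn 2) => /eqP k0; rewrite -ltnNge.
have: 'X^(2 ^ r) - ((1 + 32 * k)%:~R)%:P %| ('X - 1 : {poly rat}).
  apply: (@irreducible_root_dvdp _ K _ _ 1) => //; apply/rootP.
    rewrite k0 mulr0 addr0 rmorph1 ?polyC1 rmorphB /= map_polyXn rmorph1.
    by rewrite !hornerE expr1n subrr.
  by rewrite rmorphB /= map_polyX rmorph1 !hornerE subrr.
move/dvdp_leq; rewrite -polyC1 polyXsubC_eq0 size_XsubC size_XnsubC ?expn_gt0 //.
move=> /(_ isT); rewrite !ltnS => le1.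
have: (2 ^ 3 <= 2 ^ r)%N by rewrite leq_exp2l.
by move/leq_trans/(_ le1).
Qed.

Lemma radicand_neq1 : (1 + 32 * k)%:~R != 1 :> K.
Proof.
rewrite rmorphD rmorph1 -subr_eq0 addrAC subrr add0r.
rewrite intr_fext_eq0 mulf_eq0.
by rewrite (negPf radicand_shift_neq0).
Qed.

Lemma int_eval_integral (p : {poly int}) : in_ring_of_integers (int_eval eta p).
Proof.
apply: integral_horner eta_int; apply/integral_poly => i.
by rewrite coef_map; apply: integral_id.
Qed.

(** [V] represents [v_j] in [Z[eta]], and [rho] comes from [mod2_root_exists]. Then
    [psi_degree_one], with evaluation at [eta] as [eps] and at [rho] as [psi], bounds the
    residues. *)
Lemma degree_one_place (j d t : nat) :
    (j, d) \in [:: (1, 8); (2, 4); (4, 2)]%N -> j = (2 ^ t)%N ->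
  exists V : {poly int}, exists rho : F,
  [/\ int_eval eta V * (1 + (alpha ^+ (2 ^ (r - 3))) ^+ j)
        = (- (4 * k * j%:R))%:~R,
      int_eval rho V != 0,
      forall p, int_eval eta p = 0 -> int_eval rho p = 0
    & rho = 0 \/ rho = 1].
Proof.
move=> jd Dj; set e := (2 ^ (r - 3 + t))%N.
have De : (alpha ^+ (2 ^ (r - 3))) ^+ j = alpha ^+ e.
  by rewrite -exprM Dj -expnD.
have [jd8 d_gt0] : (j * d = 8)%N /\ (0 < d)%N.
  by move: jd; rewrite !inE => /or3P[] /eqP[-> ->].
have nde : (2 ^ r = d * e)%N.
  by rewrite /e expnD -Dj mulnCA [(d * j)%N]mulnC jd8 -[8%N]/(2 ^ 3)%N -expnD subnK.
have nz_j : j%:R != 0 :> int.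
  by move: jd; rewrite !inE => /or3P[] /eqP[-> _].
have nz_k := radicand_shift_neq0.
have nz_m : - (4 * k * j%:R) != 0 by rewrite oppr_eq0 !mulf_neq0.
have nz_m' : (- (4 * k * j%:R))%:~R != 0 :> K.
  by rewrite intr_fext_eq0.
have deltad : (alpha ^+ e) ^+ d = (1 + 32 * k)%:~R.
  by rewrite -exprM mulnC -nde.
have nz_delta : 1 + alpha ^+ e != 0.
  (* If [alpha ^+ e = -1], then the even power [d] gives radicand 1. *)
  apply: contraNneq radicand_neq1 => /eqP; rewrite addrC addr_eq0 => /eqP delta.
  rewrite -deltad delta; move: jd; rewrite !inE.
  by case/or3P=> /eqP[_ ->]; rewrite -signr_odd.
pose v := (- (4 * k * j%:R))%:~R / (1 + alpha ^+ e).
have vdelta : v * (1 + alpha ^+ e) = (- (4 * k * j%:R))%:~R by rewrite divfK.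
have [h szh vd] := fraction_relation jd nz_k vdelta deltad.
have [] := monic_pure_relation d_gt0 szh.
set g := _ - _ => mon_g szg.
have g0 : int_eval v g = 0.
  rewrite rmorphB rmorphD rmorphM !rmorphXn /= int_evalX vd rmorph_nat.
  by rewrite subrr.
have g1 : (2 %| g.[1])%Z.
  rewrite !hornerE !expr1n opprD addNKr.
  by rewrite rpredN -[X in X * _]/(2 : int) dvdz_mulr.
have v_int : in_ring_of_integers v by exists g => //; apply/rootP.
have [V DV] := eta_gen v_int; rewrite -int_evalE in DV.
have alpha_int := pure_root_integral (expn_gt0 2 r) alpha_root.
have [A DA] := eta_gen alpha_int; rewrite -int_evalE in DA.
have V_nonnil N q : int_eval eta V ^+ N <> 2 * int_eval eta q.
  rewrite -DV; apply: (power_not_even b_irr alpha_root nde nz_m vdelta mon_g) => //.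
  exact: int_eval_integral.
have [rho nz_V ker_rho] := mod2_root_exists iota eta_int V_nonnil.
exists V, rho; split=> //; first by rewrite -DV De.
have [D [p nz_D Dp]] := generator_denominator eta Kalpha.
have Dtheta : int_eval eta (A - 1) = alpha - 1 by rewrite rmorphB rmorph1 /= -DA.
(* The residue claim is applied to [t = 'X], which maps to [eta] in [K] and to [rho] in [F]. *)
rewrite -(int_evalX rho).
apply: (@psi_degree_one _ _ _ (int_eval eta) (int_eval rho) _ ker_rho (A - 1) V
  (r - 3 + t) d (- (k * j%:R)) h _ nz_V d_gt0 _ _ D p) => //.
- have two0 : 2 = 0 :> 'F_2 by exact: val_inj.
  by rewrite -[LHS](rmorph_nat iota) two0 rmorph0.
- rewrite /= Dtheta subr_eq0; apply: contraNneq radicand_neq1 => alpha1.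
  by rewrite -alpha_root alpha1 expr1n.
- by rewrite /= Dtheta -DV subrKC vdelta mulrN mulrA.
- by rewrite /= -DV.
by rewrite /= int_evalX Dtheta.
Qed.

End DegreeOnePlace.

(** * Three places against two residues *)

Unset Implicit Arguments.

Theorem corollary1p8 (b : int) (hb : (b = 1 %[mod 32])%Z)
    (r : nat) (hr : (3 <= r)%N)
    (hirr : irreducible_poly ('X^(2 ^ r) - (b%:~R)%:P : {poly rat}))
    (K : fieldExtType rat) (alpha : K)
    (halpha : root ('X^(2 ^ r) - (b%:~R)%:P : {poly K}) alpha)
    (hK : <<1; alpha>>%VS = {:K}%VS) :
  ~ monogenic K.
Proof.
case=> eta eta_int eta_gen; pose k : int := ((b - 1) %/ 32)%Z.
have Db : b = 1 + 32 * k.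
  have: (b == 1 %[mod 32])%Z by apply/eqP.
  by rewrite eqz_mod_dvd /k mulrC => /divzK ->; rewrite addrC subrK.
have b_irr : irreducible_poly ('X^(2 ^ r) - ((1 + 32 * k)%:~R)%:P : {poly rat}).
  by rewrite -Db.
have alpha_root : alpha ^+ (2 ^ r) = (1 + 32 * k)%:~R.
  by move: halpha; rewrite /root !hornerE -Db subr_eq0 => /eqP.
have gen x := proj1 (eta_gen x).
have [F [iota _]] := countable_algebraic_closure 'F_2.
have two0 : 2 = 0 :> F.
  have two0 : 2 = 0 :> 'F_2 by exact: val_inj.
  by rewrite -[LHS](rmorph_nat iota) two0 rmorph0.
have place := degree_one_place iota hr b_irr alpha_root hK eta_int gen.
have [V1 [rho1 [V1E nz1 ker1 rho1_01]]] := place 1%N 8%N 0%N isT erefl.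
have [V2 [rho2 [V2E nz2 ker2 rho2_01]]] := place 2%N 4%N 1%N isT erefl.
have [V4 [rho4 [V4E nz4 ker4 rho4_01]]] := place 4%N 2%N 2%N isT erefl.
have alpha_int := pure_root_integral (expn_gt0 2 r) alpha_root.
have [A DA] := gen alpha alpha_int; rewrite -int_evalE in DA.
pose beta := alpha ^+ (2 ^ (r - 3)).
have [B DB] : exists B, int_eval eta B = beta.
  by exists (A ^+ (2 ^ (r - 3))); rewrite rmorphXn /= -DA.
have beta8 : beta ^+ 8 = (1 + 32 * k)%:~R.
  by rewrite -alpha_root -exprM -[8%N]/(2 ^ 3)%N -expnD subnK.
(* A product in [2 Z[eta]] vanishes at every place over 2, so its two factors cannot both be units
   at the same [rho]. *)
have separate (V W P : {poly int}) (rho : F) :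
    int_eval eta V * int_eval eta W = 2 * int_eval eta P ->
    (forall p, int_eval eta p = 0 -> int_eval rho p = 0) ->
  int_eval rho V != 0 -> int_eval rho W != 0 -> False.
  move=> VW ker nzV nzW; suff: int_eval rho V * int_eval rho W = 0.
    by move/eqP; rewrite mulf_eq0 (negPf nzV) (negPf nzW).
  have: int_eval rho (V * W - 2 * P) = 0.
    by apply: ker; rewrite rmorphB !rmorphM rmorph_nat /= VW subrr.
  by rewrite rmorphB !rmorphM rmorph_nat two0 mul0r subr0.
have nz_k : k != 0 := radicand_shift_neq0 K hr b_irr.
rewrite -/beta in V1E V2E V4E.
set v1 := int_eval eta V1 in V1E; set v2 := int_eval eta V2 in V2E.
set v4 := int_eval eta V4 in V4E.
pose x : K := k%:~R.
have nz_int (c : int) : c != 0 -> c%:~R != 0 :> K by rewrite intr_fext_eq0.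
have nz_delta (y z : K) (c : int) : y * z = (- (4 * k * c))%:~R -> c != 0 -> z != 0.
  move=> yz nz_c; apply: contra_eq_neq yz => ->; rewrite mulr0 eq_sym.
  by apply: nz_int; rewrite oppr_eq0 !mulf_neq0.
have x8 : 32 * x = beta ^+ 8 - 1.
  by rewrite beta8 rmorphD rmorphM rmorph1 addrC addKr.
(* By [x8], each [(8 / j) * v_j] is the exact quotient of [1 - beta ^+ 8] by [1 + beta ^+ j]. *)
have D1 : 8 * v1 = (1 - beta) * (1 + beta ^+ 2) * (1 + beta ^+ 4).
  apply: (mulIf (nz_delta _ _ _ V1E isT)); rewrite -[LHS]mulrA V1E expr1.
  transitivity (- (32 * x)); first by rewrite /x; ring.
  by rewrite x8; ring.
have D2 : 4 * v2 = (1 - beta ^+ 2) * (1 + beta ^+ 4).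
  apply: (mulIf (nz_delta _ _ _ V2E isT)); rewrite -[LHS]mulrA V2E.
  transitivity (- (32 * x)); first by rewrite /x; ring.
  by rewrite x8; ring.
have D4 : 2 * v4 = 1 - beta ^+ 4.
  apply: (mulIf (nz_delta _ _ _ V4E isT)); rewrite -[LHS]mulrA V4E.
  transitivity (- (32 * x)); first by rewrite /x; ring.
  by rewrite x8; ring.
have Dv4 : 1 + beta ^+ 4 = 2 - 2 * v4 by rewrite D4; ring.
(* In each product the factors recombine into [1 - beta ^+ 8 = - 32 x]. Here the missing 2 comes
   from [1 + beta ^+ 4 = 2 (1 - v4)]. *)
have V12 : v1 * v2 = 2 * int_eval eta ((- k)%:P * (1 - B) * (1 - V4)).
  rewrite !(rmorphM, rmorphB, rmorph1) /= int_evalC DB -/v4 rmorphN -/x.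
  apply: (mulfI (nz_int 32 isT)).
  transitivity ((8 * v1) * (4 * v2)); first by ring.
  transitivity (- (32 * x) * (1 - beta) * (1 + beta ^+ 4)).
    by rewrite D1 D2 x8; ring.
  by rewrite Dv4; ring.
have V14 : v1 * v4 = 2 * int_eval eta ((- k)%:P * (1 - B) * (1 + B ^+ 2)).
  rewrite !(rmorphM, rmorphB, rmorphD, rmorph1, rmorphXn) /= int_evalC DB rmorphN -/x.
  apply: (mulfI (nz_int 16 isT)).
  transitivity ((8 * v1) * (2 * v4)); first by ring.
  transitivity (- (32 * x) * (1 - beta) * (1 + beta ^+ 2)); last by ring.
  by rewrite D1 D4 x8; ring.
have V24 : v2 * v4 = 2 * int_eval eta ((- (2 * k))%:P * (1 - B ^+ 2)).
  rewrite !(rmorphM, rmorphB, rmorph1, rmorphXn) /= int_evalC DB.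
  apply: (mulfI (nz_int 8 isT)).
  transitivity ((4 * v2) * (2 * v4)); first by ring.
  transitivity (- (32 * x) * (1 - beta ^+ 2)); last by rewrite /x; ring.
  by rewrite D2 D4 x8; ring.
have n12 : rho1 <> rho2.
  by move=> E; apply: (separate V1 V2 _ rho1 V12 ker1 nz1); rewrite E.
have n14 : rho1 <> rho4.
  by move=> E; apply: (separate V1 V4 _ rho1 V14 ker1 nz1); rewrite E.
have n24 : rho2 <> rho4.
  by move=> E; apply: (separate V2 V4 _ rho2 V24 ker2 nz2); rewrite E.
(* Pigeonhole: three distinct residues cannot all lie in [{0, 1}]. *)
by case: rho1_01 n12 n14 => ->; case: rho2_01 n24 => ->; case: rho4_01 => ->.
Qed.
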